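(* Let $X$ and $Y$ be nontrivial real Banach spaces and $1<p<\infty$. Then $X\oplus_p Y$ is not $\delta$-average rough for any $\delta>2^{1-1/p}$.
   Context: A Banach space is nontrivial if it is not $\{0\}$. For a Banach space $X$, $S_X$ denotes its unit sphere. For $\delta>0$, a Banach space $X$ is $\delta$-average rough if, whenever $n\in\mathbb{N}$ ($n\ge 1$) and $x_1,\dots,x_n\in S_X$, $$\limsup_{\|y\|\to 0}\frac1n\sum_{i=1}^n\frac{\|x_i+y\|+\|x_i-y\|-2}{\|y\|}\geq\delta,$$ where $y$ ranges over nonzero elements of $X$. $X\oplus_p Y$ is $X\times Y$ with the norm $\|(x,y)\|_p=(\|x\|^p+\|y\|^p)^{1/p}$. *)

(* Defs.v *)
From HB Require Import structures.
From mathcomp Require Import all_boot all_order all_algebra.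
From mathcomp Require Import all_classical all_reals all_analysis.
From mathcomp Require Import ring lra.

Set Implicit Arguments.
Unset Strict Implicit.
Unset Printing Implicit Defensive.

Import Order.TTheory GRing.Theory Num.Theory.
Import numFieldNormedType.Exports.

Local Open Scope classical_set_scope.
Local Open Scope ring_scope.

Definition rough_mean (R : realType) (X : normedModType R) (n : nat)
    (x : 'I_n -> X) (y : X) : R :=
  n%:R^-1 * \sum_(i < n) ((`|x i + y| + `|x i - y| - 2) / `|y|).

Definition average_rough (R : realType) (X : completeNormedModType R)
    (delta : R) : Prop :=
  forall (n : nat) (x : 'I_n -> X), (0 < n)%N -> (forall i, `|x i| = 1) ->
  (delta%:E <= limf_esup (EFin \o rough_mean x) (dnbhs (0%R : X)))%E.

(* The carrier is a type alias of X * Y: the library already equips X * Y with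
   the max norm.  The proof of 1 < p is an argument of the type so that the
   normed-space instances below can be inferred. *)
Definition lp_sum (R : realType) (p : R) (p1 : 1 < p)
  (X Y : normedModType R) : Type := (X * Y)%type.

Definition lp_sum_norm (R : realType) (p : R) (X Y : normedModType R)
  (z : X * Y) : R := (`|z.1| `^ p + `|z.2| `^ p) `^ p^-1.

Section minkowski_pair.
Context (R : realType) (p : R) (p1 : 1 < p).

Let p0 : 0 < p. Proof. exact: lt_trans p1. Qed.
Let pn0 : p != 0. Proof. by rewrite gt_eqF. Qed.

Let convex_comb (s t a b : R) : 0 < s -> 0 < t -> 0 <= a -> 0 <= b ->
  ((a + b) / (s + t)) `^ p <=
  s / (s + t) * (a / s) `^ p + t / (s + t) * (b / t) `^ p.
Proof.
move=> s0 t0 a0 b0.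
have st0 : 0 < s + t by rewrite addr_gt0.
have l0 : 0 <= s / (s + t) by rewrite divr_ge0// ltW.
have l1 : s / (s + t) <= 1 by rewrite ler_pdivrMr// mul1r lerDl ltW.
have stE : t / (s + t) = 1 - s / (s + t) by field; lra.
have := convex_powR (ltW p1) (Itv01 l0 l1).
move=> /(_ (a / s) (b / t)); rewrite !inE/= !in_itv/= !andbT.
move=> /(_ (divr_ge0 a0 (ltW s0)) (divr_ge0 b0 (ltW t0))).
rewrite !convRE/= /unstable.onem -stE.
set c := (X in X `^ p <= _ -> _).
have -> : c = s / (s + t) * (a / s) + (1 - s / (s + t)) * (b / t) by [].
rewrite -stE.
have -> // : s / (s + t) * (a / s) + t / (s + t) * (b / t) = (a + b) / (s + t).
by field; rewrite !gt_eqF.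
Qed.

Lemma minkowski_pair (a1 a2 b1 b2 : R) :
  0 <= a1 -> 0 <= a2 -> 0 <= b1 -> 0 <= b2 ->
  ((a1 + b1) `^ p + (a2 + b2) `^ p) `^ p^-1 <=
  (a1 `^ p + a2 `^ p) `^ p^-1 + (b1 `^ p + b2 `^ p) `^ p^-1.
Proof.
move=> a10 a20 b10 b20.
set s := (a1 `^ p + a2 `^ p) `^ p^-1; set t := (b1 `^ p + b2 `^ p) `^ p^-1.
have pV0 : p^-1 != 0 by rewrite invr_eq0.
have N0 (c d : R) : 0 <= c -> 0 <= d -> (c `^ p + d `^ p) `^ p^-1 = 0 ->
    c = 0 /\ d = 0.
  move=> c0 d0 /powR_eq0_eq0 /eqP; rewrite paddr_eq0 ?powR_ge0//.
  by case/andP => /eqP/powR_eq0_eq0 -> /eqP/powR_eq0_eq0 ->.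
have [s0|sn0] := eqVneq s 0.
  by have [-> ->] := N0 _ _ a10 a20 s0; rewrite !add0r s0 add0r.
have [t0|tn0] := eqVneq t 0.
  by have [-> ->] := N0 _ _ b10 b20 t0; rewrite !addr0 t0 addr0.
have s0 : 0 < s by rewrite lt_neqAle eq_sym sn0 powR_ge0.
have t0 : 0 < t by rewrite lt_neqAle eq_sym tn0 powR_ge0.
have rK (c d : R) : ((c `^ p + d `^ p) `^ p^-1) `^ p = c `^ p + d `^ p.
  by rewrite -powRrM mulVf// powRr1// addr_ge0// powR_ge0.
have sE : s `^ p = a1 `^ p + a2 `^ p by exact: rK.
have tE : t `^ p = b1 `^ p + b2 `^ p by exact: rK.
clearbody s t; have st0 : 0 < s + t by rewrite addr_gt0.
have divE (c d : R) : 0 <= c -> 0 < d -> (c / d) `^ p = c `^ p / d `^ p.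
  move=> c0 d0; rewrite powRM// ?invr_ge0 ?(ltW d0)//.
  rewrite -(powR_inv1 (ltW d0)) -powRrM mulN1r powRN.
  by [].
have H1 := convex_comb s0 t0 a10 b10.
have H2 := convex_comb s0 t0 a20 b20.
have K : (a1 + b1) `^ p + (a2 + b2) `^ p <= (s + t) `^ p.
  rewrite -[leRHS]mul1r -ler_pdivrMr ?powR_gt0// mulrDl.
  rewrite -!divE ?addr_ge0//.
  apply: (le_trans (lerD H1 H2)).
  rewrite !divE// addrACA -!mulrDr -!mulrDl -sE -tE.
  rewrite !divff ?gt_eqF ?powR_gt0// !mulr1 -mulrDl divff// gt_eqF//.
have -> : s + t = ((s + t) `^ p) `^ p^-1.
  by rewrite -powRrM mulfV// powRr1// ltW.
by rewrite ge0_ler_powR ?nnegrE ?invr_ge0 ?(ltW p0) ?addr_ge0 ?powR_ge0.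
Qed.

End minkowski_pair.

Section lp_sum_normed.
Context (R : realType) (p : R) (p1 : 1 < p) (X Y : normedModType R).
Local Notation T := (lp_sum p1 X Y).
Local Notation N := (@lp_sum_norm R p X Y).

Let p0 : 0 < p. Proof. exact: lt_trans p1. Qed.
Let pn0 : p != 0. Proof. by rewrite gt_eqF. Qed.

HB.instance Definition _ := GRing.Lmodule.copy T (X * Y)%type.

Let ler_normD (x y : T) : N (x + y) <= N x + N y.
Proof.
apply: le_trans (minkowski_pair p1 _ _ _ _); rewrite ?normr_ge0//.
rewrite /lp_sum_norm ge0_ler_powR ?nnegrE ?invr_ge0 ?addr_ge0 ?powR_ge0//.
  exact: ltW.
by rewrite lerD// ge0_ler_powR ?nnegrE ?addr_ge0 ?ler_normD// ltW.
Qed.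

Let normrZ (l : R) (x : T) : N (l *: x) = `|l| * N x.
Proof.
rewrite /lp_sum_norm /= !normrZ !powRM// -mulrDr powRM ?addr_ge0 ?powR_ge0//.
by rewrite -powRrM mulfV// powRr1.
Qed.

Let normr0_eq0 (x : T) : N x = 0 -> x = 0.
Proof.
move/powR_eq0_eq0/eqP; rewrite paddr_eq0 ?powR_ge0//.
case: x => x y /= /andP[/eqP/powR_eq0_eq0/eqP + /eqP/powR_eq0_eq0/eqP].
by rewrite !normr_eq0 => /eqP -> /eqP ->.
Qed.

HB.instance Definition _ :=
  Lmodule_isNormed.Build R T ler_normD normrZ normr0_eq0.

Lemma lp_sum_normE (z : T) : `|z| = (`|z.1| `^ p + `|z.2| `^ p) `^ p^-1.
Proof. by []. Qed.

Lemma lp_sum_norm_fst (z : T) : `|z.1| <= `|z|.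
Proof.
rewrite lp_sum_normE -[leLHS](powRr1 (normr_ge0 _)) -(mulfV pn0) powRrM.
rewrite ge0_ler_powR ?nnegrE ?invr_ge0 ?addr_ge0 ?powR_ge0 ?(ltW p0)//.
by rewrite lerDl powR_ge0.
Qed.

Lemma lp_sum_norm_snd (z : T) : `|z.2| <= `|z|.
Proof.
rewrite lp_sum_normE -[leLHS](powRr1 (normr_ge0 _)) -(mulfV pn0) powRrM.
rewrite ge0_ler_powR ?nnegrE ?invr_ge0 ?addr_ge0 ?powR_ge0 ?(ltW p0)//.
by rewrite lerDr powR_ge0.
Qed.

Lemma lp_sum_norm_le (z : T) : `|z| <= `|z.1| + `|z.2|.
Proof.
have := minkowski_pair p1 (normr_ge0 z.1) (lexx 0) (lexx 0) (normr_ge0 z.2).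
rewrite addr0 add0r powR0// addr0 add0r -!powRrM mulfV// !powRr1//.
Qed.

End lp_sum_normed.

Section lp_sum_complete.
Context (R : realType) (p : R) (p1 : 1 < p) (X Y : completeNormedModType R).
Local Notation T := (lp_sum p1 X Y).

Let cauchy_comp (Z : completeNormedModType R) (f : T -> Z) (F : set_system T) :
  (forall u v, `|f u - f v| <= `|u - v|) ->
  ProperFilter F -> cauchy F -> cvg (f @ F).
Proof.
move=> fle FF /cauchy_ballP cF; apply: cauchy_cvg; apply/cauchy_ballP => e e0.
have [[A B] [/= FA FB] AB] := cF _ e0.
exists (f @` A, f @` B) => /=.
  by split; [move: FA|move: FB]; apply: filterS => x Ax; exists x.
move=> [_ _] [/= [u Au <-] [v Bv <-]] /=.
have := AB (u, v) (conj Au Bv); rewrite -!ball_normE/=.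
exact: le_lt_trans.
Qed.

Let lp_sum_cauchy_cvg (F : set_system T) :
  ProperFilter F -> cauchy F -> cvg F.
Proof.
move=> FF cF.
have /cvg_ex[/= a Fa] : cvg ((fst : T -> X) @ F).
  by apply: cauchy_comp => // u v; exact: (lp_sum_norm_fst (u - v)).
have /cvg_ex[/= b Fb] : cvg ((snd : T -> Y) @ F).
  by apply: cauchy_comp => // u v; exact: (lp_sum_norm_snd (u - v)).
apply/cvg_ex; exists ((a, b) : T); apply/cvgrPdist_lt => e e0.
have e20 : 0 < e / 2 by rewrite divr_gt0.
move/cvgrPdist_lt : Fa => /(_ _ e20) Fa.
move/cvgrPdist_lt : Fb => /(_ _ e20) Fb.
near=> z; rewrite (le_lt_trans (lp_sum_norm_le _))// (splitr e) ltrD//.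
- by near: z.
- by near: z.
Unshelve. all: by end_near. Qed.

HB.instance Definition _ := Uniform_isComplete.Build T lp_sum_cauchy_cvg.

End lp_sum_complete.

(* Main.v *)
Require Import Defs.
From mathcomp Require Import all_boot all_order all_algebra.
From mathcomp Require Import all_classical all_reals all_analysis.
From mathcomp Require Import lra.

Import Order.TTheory GRing.Theory Num.Theory.
Import numFieldNormedType.Exports.

Local Open Scope ring_scope.

(** Only two points of the sphere are needed: [(x, 0)] and [(0, y)], with [x]
    and [y] unit vectors.  Let [z = (u, v)] have norm [r].  Moving [(x, 0)] by
    [z] changes the first coordinate to first order, by at most [`|u|], whereas
    the second coordinate enters the norm only through [`|v| `^ p], which is
    [o(r)] because [p > 1].  So the second difference of the norm at [(x, 0)]
    is at most [2 * (`|u| + `|v| `^ p)] ([second_difference_inl]), and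
    the one at [(0, y)] is at most [2 * (`|v| + `|u| `^ p)].  Averaging the two
    and dividing by [r] leaves at most [(`|u| + `|v|) / r + r `^ (p - 1)], and
    the l^1 norm of a pair is at most [2 `^ (1 - p^-1)] times its l^p norm
    ([add_le_lp_sum_norm]).  As [r] tends to [0] the error term vanishes, so
    the upper limit is at most [2 `^ (1 - p^-1)]. *)

(** A coordinate [t] transversal to the point of the sphere adds at most
    [t `^ p] to the bound on the norm, a term of higher order.  With [c := 1 + a >= 1],
    this is the elementary estimate [(c + t `^ p) `^ p =
    (c + t `^ p) * (c + t `^ p) `^ (p - 1) >= c * c `^ (p - 1) + t `^ p]. *)
Lemma lp_norm_transversal (R : realType) (p s a t : R) : 1 < p ->
  0 <= s -> 0 <= a -> s <= 1 + a ->
  (s `^ p + t `^ p) `^ p^-1 <= 1 + a + t `^ p.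
Proof.
move=> p1 s0 a0 sa; have p0 : 0 < p by lra.
have T0 : 0 <= t `^ p by exact: powR_ge0.
move: (t `^ p) T0 => T T0; set c := 1 + a in sa *.
have c1 : 1 <= c by rewrite /c; lra.
clearbody c.
have c0 : 0 <= c by lra.
rewrite -[leRHS](powRr1 (addr_ge0 c0 T0)) -(mulfV (lt0r_neq0 p0)) powRrM.
rewrite ge0_ler_powR ?nnegrE ?invr_ge0 ?addr_ge0 ?powR_ge0 ?(ltW p0)//.
apply: (@le_trans _ _ (c `^ p + T)).
  by rewrite lerD2r ge0_ler_powR ?nnegrE ?(ltW p0).
rewrite -(mulr_powRB1 c0 p0) -(mulr_powRB1 (addr_ge0 c0 T0) p0) mulrDl.
have p10 : 0 <= p - 1 by lra.
apply: lerD.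
  by rewrite ler_wpM2l// ge0_ler_powR// ?nnegrE ?addr_ge0// lerDl.
by rewrite ler_peMr// -[leLHS](powRr0 (c + T)) ler_powR// ler_wpDr.
Qed.

Lemma rough_mean_two (R : realType) (V : normedModType R) (x : 'I_2 -> V)
    (z : V) :
  rough_mean x z = 2^-1 * ((`|x ord0 + z| + `|x ord0 - z| - 2) +
    (`|x ord_max + z| + `|x ord_max - z| - 2)) / `|z|.
Proof.
rewrite /rough_mean -mulr_suml -mulrA big_ord_recl big_ord1.
by have -> : lift ord0 (ord0 : 'I_1) = ord_max by apply: val_inj.
Qed.

Section lp_sum_roughness.
Context (R : realType) (p : R) (p1 : 1 < p) (X Y : normedModType R).
Local Notation T := (lp_sum p1 X Y).

Let p0 : 0 < p. Proof. exact: lt_trans p1. Qed.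

Lemma lp_sum_normX (z : T) : `|z| `^ p = `|z.1| `^ p + `|z.2| `^ p.
Proof.
by rewrite lp_sum_normE -powRrM mulVf ?lt0r_neq0// powRr1 ?addr_ge0 ?powR_ge0.
Qed.

Lemma norm_lp_sum_inl (x : X) : `|(x, 0) : T| = `|x|.
Proof.
by rewrite lp_sum_normE/= normr0 powR0 ?lt0r_neq0// addr0 -powRrM mulfV
  ?lt0r_neq0// powRr1.
Qed.

Lemma norm_lp_sum_inr (y : Y) : `|(0, y) : T| = `|y|.
Proof.
by rewrite lp_sum_normE/= normr0 powR0 ?lt0r_neq0// add0r -powRrM mulfV
  ?lt0r_neq0// powRr1.
Qed.

(** Minkowski's inequality for [(a, b)] and its swap [(b, a)], where [a] and
    [b] are the norms of the two coordinates: the sum is a constant pair, of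
    l^p norm [2 `^ p^-1 * (a + b)]. *)
Lemma add_le_lp_sum_norm (z : T) :
  `|z.1| + `|z.2| <= 2 `^ (1 - p^-1) * `|z|.
Proof.
have := minkowski_pair p1 (normr_ge0 z.1) (normr_ge0 z.2)
  (normr_ge0 z.2) (normr_ge0 z.1).
rewrite [X in _ <= _ + X `^ _]addrC -lp_sum_normE.
rewrite [X in (_ + X `^ _) `^ _]addrC.
rewrite -[X in X `^ p^-1]mulr2n -[X in X `^ p^-1]mulr_natl.
rewrite powRM ?powR_ge0// -powRrM mulfV ?lt0r_neq0// powRr1 ?addr_ge0// => H.
rewrite powRB ?pnatr_eq0 ?implybT// powRr1// mulrAC ler_pdivlMr ?powR_gt0//.
by rewrite mulrC mulr_natl mulr2n.
Qed.

(** [z] and [- z] have the same coordinate norms, so one use of the triangle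
    inequality in [X], followed by [lp_norm_transversal] for the [Y]-coordinate,
    bounds both perturbed norms. *)
Lemma second_difference_inl (x : X) (z : T) : `|x| = 1 ->
  `|(x, 0) + z : T| + `|(x, 0) - z : T| - 2 <= 2 * (`|z.1| + `|z.2| `^ p).
Proof.
move=> x1.
have H (w : T) : `|w.1| = `|z.1| -> `|w.2| = `|z.2| ->
    `|(x, 0) + w : T| <= 1 + `|z.1| + `|z.2| `^ p.
  move=> <- <-; rewrite lp_sum_normE/= add0r; apply: lp_norm_transversal => //.
  by rewrite -x1 ler_normD.
have Hz := H z erefl erefl; have HNz := H (- z) (normrN _) (normrN _).
rewrite lerBlDr (le_trans (lerD Hz HNz))//.
move: (`|z.1|) (`|z.2| `^ p) {Hz HNz} => a b; lra.
Qed.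

Lemma second_difference_inr (y : Y) (z : T) : `|y| = 1 ->
  `|(0, y) + z : T| + `|(0, y) - z : T| - 2 <= 2 * (`|z.2| + `|z.1| `^ p).
Proof.
move=> y1.
have H (w : T) : `|w.1| = `|z.1| -> `|w.2| = `|z.2| ->
    `|(0, y) + w : T| <= 1 + `|z.2| + `|z.1| `^ p.
  move=> <- <-; rewrite lp_sum_normE/= add0r addrC.
  by apply: lp_norm_transversal => //; rewrite -y1 ler_normD.
have Hz := H z erefl erefl; have HNz := H (- z) (normrN _) (normrN _).
rewrite lerBlDr (le_trans (lerD Hz HNz))//.
move: (`|z.2|) (`|z.1| `^ p) {Hz HNz} => a b; lra.
Qed.

Definition axis_points (x : X) (y : Y) (i : 'I_2) : T :=
  if i == ord0 then (x, 0) else (0, y).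

Lemma rough_mean_axis_points (x : X) (y : Y) (z : T) :
  `|x| = 1 -> `|y| = 1 -> z != 0 ->
  rough_mean (axis_points x y) z <= 2 `^ (1 - p^-1) + `|z| `^ (p - 1).
Proof.
move=> x1 y1 z0; have r0 : 0 < `|z| by rewrite normr_gt0.
rewrite rough_mean_two /axis_points/= ler_pdivrMr//.
rewrite [leRHS]mulrDl [_ `^ (p - 1) * _]mulrC mulr_powRB1// lp_sum_normX.
apply: (@le_trans _ _ (2^-1 * (2 * (`|z.1| + `|z.2| `^ p)
    + 2 * (`|z.2| + `|z.1| `^ p)))).
  rewrite ler_wpM2l// lerD//.
    exact: second_difference_inl.
  exact: second_difference_inr.
have := add_le_lp_sum_norm z.
move: (`|z.1|) (`|z.2|) (2 `^ _ * _) => a b c; lra.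
Qed.

End lp_sum_roughness.

Lemma limf_esup_dnbhs0_le (R : realType) (V : normedModType R) (f : V -> R)
    (e c : R) : 0 < e ->
  (forall z : V, z != 0 -> `|z| < e -> f z <= c) ->
  (limf_esup (EFin \o f) (dnbhs (0%R : V)) <= c%:E)%E.
Proof.
move=> e0 fc; rewrite limf_esupE.
pose U : set V := [set z | z != 0 /\ `|z| < e]%classic.
apply: (@le_trans _ _ (ereal_sup ((EFin \o f) @` U)%classic)).
  apply: ereal_inf_lbound; exists U => //.
  by apply: filterI; [exact: nbhs_dnbhs_neq|exact: dnbhs0_lt].
by apply: ge_ereal_sup => _ [z [z0 ze] <-] /=; rewrite lee_fin fc.
Qed.

Lemma exists_norm1 (R : realType) (V : normedModType R) :
  (exists v : V, v != 0) -> exists v : V, `|v| = 1.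
Proof.
move=> [v v0]; exists (`|v|^-1 *: v).
by rewrite normrZ normfV normr_id mulVf ?normr_eq0.
Qed.

Theorem proposition2p7 (R : realType) (X Y : completeNormedModType R)
    (hX : exists x : X, x != 0) (hY : exists y : Y, y != 0)
    (p : R) (p1 : 1 < p) (delta : R) (hdelta : 2 `^ (1 - p^-1) < delta) :
  ~ average_rough (lp_sum p1 X Y) delta.
Proof.
have [x x1] := exists_norm1 _ _ hX; have [y y1] := exists_norm1 _ _ hY.
move=> /(_ 2%N (axis_points R p p1 X Y x y) isT) rough.
have axis1 i : `|axis_points R p p1 X Y x y i| = 1.
  by rewrite /axis_points; case: ifP => _;
    rewrite (norm_lp_sum_inl, norm_lp_sum_inr).
have {rough axis1} := rough axis1; apply/negP; rewrite -ltNge.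
set c := 2 `^ (1 - p^-1) in hdelta *; pose eta := (delta - c) / 2.
have eta0 : 0 < eta by rewrite /eta; lra.
have q0 : 0 < p - 1 by lra.
apply: (@le_lt_trans _ _ (c + eta)%:E); last by rewrite lte_fin /eta; lra.
(* the radius for which the error term [`|z| `^ (p - 1)] is at most [eta] *)
apply: (limf_esup_dnbhs0_le _ _ _ (eta `^ (p - 1)^-1)).
  exact: powR_gt0.
move=> z z0 ze.
apply: (le_trans (rough_mean_axis_points _ _ _ _ _ _ _ _ x1 y1 z0)).
have etaE : eta = (eta `^ (p - 1)^-1) `^ (p - 1).
  by rewrite -powRrM mulVf ?lt0r_neq0// powRr1// ltW.
by rewrite lerD2l [leRHS]etaE ge0_ler_powR ?nnegrE ?powR_ge0// ltW.
Qed.
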